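(* For the deterministic inventory model and the ordering policy $(\mathbf t,\mathbf y)$ described in the context, the collection of average ordering measures $\{m_{1,t}:t>0\}$ is not tight.
   Context: Model. An ordering policy $(\mathbf t,\mathbf y)$ is a sequence of order times $t_k$ and nonnegative order sizes $y_k$, and the inventory process is $x(t)=-t+\sum_kI_{\{t_k\le t\}}y_k$ (initial level $0$ before any order; demand rate $1$). Let $\overline{\mathcal R}=\{(y,z)\in\mathbb R^2:y\le z\}$. For $t>0$ the average ordering measure is $$m_{1,t}(\Gamma_1)=\frac1t\sum_kI_{\{t_k\le t\}}I_{\Gamma_1}(x(t_k-),x(t_k)),\qquad\Gamma_1\in\mathcal B(\overline{\mathcal R}).$$ Not tight means: for some $\epsilon>0$ and every compact $\Gamma\subset\overline{\mathcal R}$ there is some $t>0$ with $m_{1,t}(\Gamma^c)>\epsilon$. Policy. Orders are indexed by pairs $(i,j)$: cycle $i=1,2,3,\dots$ and order number $j=1,\dots,2^i+1$ within cycle $i$ (listed lexicographically this gives the single-index sequence). Set $t_{1,1}=0$ and, for $i\ge2$, $t_{i,1}=t_{i-1,2^{i-1}+1}+2^{(i-2)/2}$. For each $i\ge1$: Phase 1: $y_{i,1}=1$, and $t_{i,j}=t_{i,j-1}+1$, $y_{i,j}=1$ for $j=2,\dots,2^{i-1}$. Phase 2: $t_{i,2^{i-1}+1}=t_{i,2^{i-1}}+1$, $y_{i,2^{i-1}+1}=2^{(i-1)/2}$; and $t_{i,2^{i-1}+1+j}=t_{i,2^{i-1}+1}$, $y_{i,2^{i-1}+1+j}=0$ for $j=1,\dots,2^{i-1}$.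 Thus each nonzero order is placed when the level hits $0$; cycle $i$ ends when $x$ hits $0$ at time $t_{i+1,1}$. Convention. $(x(t_k-),x(t_k))$ denotes the levels just before and just after order $k$; simultaneous orders are applied one after another, so each $0$-size order of cycle $i$ contributes the pair $(2^{(i-1)/2},2^{(i-1)/2})$, the preceding large order contributes $(0,2^{(i-1)/2})$, and each Phase 1 order (including that at time $0$) contributes $(0,1)$. *)

(* Defs.v *)
From HB Require Import structures.
From mathcomp Require Import all_boot all_order all_algebra.
From mathcomp Require Import all_classical all_reals all_analysis.

Set Implicit Arguments.
Unset Strict Implicit.
Unset Printing Implicit Defensive.

Import Order.TTheory GRing.Theory Num.Theory.
Import numFieldNormedType.Exports.

Local Open Scope classical_set_scope.
Local Open Scope ring_scope.

(* Orders are numbered from 0. *)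
Record ordering_policy (R : realType) := OrderingPolicy {
  order_time : nat -> R;
  order_size : nat -> R;
  order_size_ge0 : forall k, 0 <= order_size k }.

Definition inventory (R : realType) (p : ordering_policy R) (t : R) : R :=
  - t + \big[+%R/0]_(0 <= k <oo | order_time p k <= t) order_size p k.

(* The left limit x(t_k-) does not see the orders placed exactly at time t_k;
   among those, the ones of smaller index have been applied before order k. *)
Definition level_before (R : realType) (p : ordering_policy R) (k : nat) : R :=
  lim (inventory p s @[s --> (order_time p k)^'-]) +
  \sum_(l < k | order_time p l == order_time p k) order_size p l.

Definition level_after (R : realType) (p : ordering_policy R) (k : nat) : R :=
  level_before p k + order_size p k.

Definition Rbar (R : realType) : set (R * R) := [set u | u.1 <= u.2].

(* The formula makes sense for every set; it is a measure on Borel sets, and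
   the complements of compact sets used below are Borel. *)
Definition avg_ordering_measure (R : realType) (p : ordering_policy R)
    (t : R) (G : set (R * R)) : \bar R :=
  ((t^-1)%:E * \sum_(k <oo | (order_time p k <= t)%R)
                 (\1_G (level_before p k, level_after p k))%:E)%E.

Definition tight (R : realType) (m : R -> set (R * R) -> \bar R) : Prop :=
  forall e : R, 0 < e ->
    exists G : set (R * R), [/\ compact G, G `<=` @Rbar R &
      forall t : R, 0 < t -> (m t (@Rbar R `\` G) <= e%:E)%E].

Definition not_tight (R : realType) (m : R -> set (R * R) -> \bar R) : Prop :=
  exists e : R, 0 < e /\
    forall G : set (R * R), compact G -> G `<=` @Rbar R ->
      exists t : R, 0 < t /\ (e%:E < m t (@Rbar R `\` G))%E.

Lemma not_tightP (R : realType) (m : R -> set (R * R) -> \bar R) :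
  not_tight m <-> ~ tight m.
Proof.
split=> [[e [e0 H]] /(_ e e0)[G [cG sG mG]]|nT].
  have [t [t0]] := H G cG sG.
  by rewrite ltNge mG.
apply: contrapT => H; apply: nT => e e0.
apply: contrapT => H'; apply: H; exists e; split=> // G cG sG.
apply: contrapT => H''; apply: H'; exists G; split=> // t t0.
by rewrite leNgt; apply/negP => lt; apply: H''; exists t.
Qed.

(* Order number j of cycle i, with i, j >= 1 as in the text; values at i = 0 or
   j = 0 are never used.  [time_in_cycle s i j] is the time of that order when
   cycle i starts at time s. *)
Fixpoint time_in_cycle (R : realType) (s : R) (i j : nat) : R :=
  if j is j'.+1 then
    if j' == 0%N then s
    else if (j <= (2 ^ i.-1).+1)%N then time_in_cycle s i j' + 1
    else time_in_cycle s i j'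
  else s.

Fixpoint cycle_start (R : realType) (i : nat) : R :=
  if i is i'.+1 then
    if i' == 0%N then 0
    else time_in_cycle (cycle_start R i') i' (2 ^ i').+1
         + 2 `^ ((i%:R - 2) / 2)
  else 0.

Definition cycle_time (R : realType) (i j : nat) : R :=
  time_in_cycle (cycle_start R i) i j.

Definition cycle_size (R : realType) (i j : nat) : R :=
  if (j <= 2 ^ i.-1)%N then 1
  else if j == (2 ^ i.-1).+1 then 2 `^ ((i%:R - 1) / 2)
  else 0.

Definition next_order (ij : nat * nat) : nat * nat :=
  if (ij.2 < (2 ^ ij.1).+1)%N then (ij.1, ij.2.+1) else (ij.1.+1, 1%N).

(* The pair (i, j) carried by the k-th order in the lexicographic listing. *)
Definition order_index (k : nat) : nat * nat := iter k next_order (1, 1)%N.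

Lemma cycle_size_ge0 (R : realType) (i j : nat) : 0 <= cycle_size R i j.
Proof.
by rewrite /cycle_size; case: ifP => // _; case: ifP => // _; exact: powR_ge0.
Qed.

Definition cyclic_policy (R : realType) : ordering_policy R :=
  @OrderingPolicy R
    (fun k => cycle_time R (order_index k).1 (order_index k).2)
    (fun k => cycle_size R (order_index k).1 (order_index k).2)
    (fun k => cycle_size_ge0 R (order_index k).1 (order_index k).2).

Lemma cycle_time11 (R : realType) : cycle_time R 1 1 = 0.
Proof. by []. Qed.

Lemma cycle_time_start (R : realType) (i : nat) : (2 <= i)%N ->
  cycle_time R i 1
  = cycle_time R i.-1 (2 ^ i.-1).+1 + 2 `^ ((i%:R - 2) / 2).
Proof. by case: i => [|[|i]]. Qed.

Lemma cycle_timeS (R : realType) (i j : nat) : (2 <= j <= (2 ^ i.-1).+1)%N ->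
  cycle_time R i j = cycle_time R i j.-1 + 1.
Proof. by case: j => [|[|j]] //= jle; rewrite /cycle_time /= jle. Qed.

Lemma cycle_time_last (R : realType) (i j : nat) :
  cycle_time R i ((2 ^ i.-1).+1 + j) = cycle_time R i (2 ^ i.-1).+1.
Proof.
elim: j => [|j IH]; first by rewrite addn0.
rewrite addnS -IH {1}/cycle_time.
have -> : forall s n, (2 ^ i.-1 < n)%N ->
    time_in_cycle s i n.+1 = time_in_cycle s i n :> R.
- by move=> s [|n] //= lt; rewrite ltnS leqNgt lt.
- by [].
- by rewrite addSn ltnS leq_addr.
Qed.

(* Main.v *)
(* At the end of Phase 1 of cycle n+1 the level is 0, the order of size
   2^(n/2) raises it to 2^(n/2), and the 2^n subsequent orders of size 0 all
   contribute a pair with both coordinates 2^(n/2).  This happens at time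
   t <= 3 * 2^n, so m_{1,t} gives mass at least 1/3 to a point which leaves
   every compact set as n grows. *)

Require Import Defs.
From mathcomp Require Import all_boot all_order all_algebra.
From mathcomp Require Import all_classical all_reals all_analysis.
From mathcomp Require Import zify lra.

Set Implicit Arguments.
Unset Strict Implicit.
Unset Printing Implicit Defensive.

Import Order.TTheory GRing.Theory Num.Theory.
Import numFieldNormedType.Exports.

Local Open Scope classical_set_scope.
Local Open Scope ring_scope.

(** * Inventory levels when order times are nondecreasing *)

Section NondecreasingTimes.
Context (R : realType) (p : ordering_policy R).
Context (time_homo : {homo order_time p : k l / (k <= l)%N >-> k <= l}).

(** By monotonicity exactly the orders [0..K] pass the time filter at [s], so the partial sums of
    the series are constant from [K.+1] on. *)
Lemma inventory_between (K : nat) (s : R) :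
  order_time p K <= s < order_time p K.+1 ->
  inventory p s = - s + \sum_(k < K.+1) order_size p k.
Proof.
move=> /andP[Ks sK]; rewrite /inventory; congr (_ + _).
apply: lim_near_cst => //; near=> n.
have Kn : (K.+1 <= n)%N by near: n; exact: nbhs_infty_ge.
rewrite (big_cat_nat (leq0n _) Kn)//=
  [X in _ + X]big_nat_cond [X in _ + X]big1 ?addr0; last first.
  move=> k /andP[/andP[Kk _]]; rewrite leNgt => /negP[].
  by rewrite (lt_le_trans sK)// time_homo.
rewrite big_mkord; apply: eq_bigl => k.
by rewrite (le_trans _ Ks)// time_homo// -ltnS.
Unshelve. all: by end_near. Qed.

(** The strict gap leaves room for a left neighbourhood of the later time on which the inventory is
    affine. *)
Lemma inventory_left_lim (K : nat) : order_time p K < order_time p K.+1 ->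
  lim (inventory p s @[s --> (order_time p K.+1)^'-]) =
  - order_time p K.+1 + \sum_(k < K.+1) order_size p k.
Proof.
move=> KK; apply: cvg_lim => //.
have : - s + \sum_(k < K.+1) order_size p k @[s --> (order_time p K.+1)^'-] -->
    - order_time p K.+1 + \sum_(k < K.+1) order_size p k.
  apply: cvg_at_left_filter; apply: cvgD; last exact: cvg_cst.
  by apply: cvgN; exact: cvg_id.
apply: cvg_trans; apply: near_eq_cvg; near=> s.
apply/esym/inventory_between/andP; split.
  by apply: ltW; near: s; exact: nbhs_left_gt.
by near: s; exact: nbhs_left_lt.
Unshelve. all: by end_near. Qed.

End NondecreasingTimes.

(** * Times, sizes and levels of the cyclic policy *)

Section CyclicPolicy.
Context (R : realType).

Let T := order_time (cyclic_policy R).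
Let Y := order_size (cyclic_policy R).

(* The index of the first order of cycle [n.+1]. *)
Definition cycle_offset (n : nat) : nat := \sum_(i < n) (2 ^ i.+1).+1.

Lemma order_indexS (k : nat) : order_index k.+1 = next_order (order_index k).
Proof. by []. Qed.

Lemma order_index_cycle (n j : nat) : (j <= 2 ^ n.+1)%N ->
  order_index (cycle_offset n + j) = (n.+1, j.+1).
Proof.
elim: n j => [|n IHn]; elim=> [|j IHj] jn.
- by rewrite /cycle_offset big_ord0.
- by rewrite addnS order_indexS IHj ?(ltnW jn)// /next_order/= ltnS jn.
- rewrite addn0 /cycle_offset big_ord_recr/= -/(cycle_offset n) addnS.
  by rewrite order_indexS IHn// /next_order/= ltnn.
- by rewrite addnS order_indexS IHj ?(ltnW jn)// /next_order/= ltnS jn.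
Qed.

Lemma order_index_range (k : nat) :
  exists n m, order_index k = (n.+1, m.+1) /\ (m <= 2 ^ n.+1)%N.
Proof.
elim: k => [|k [n [m [E mn]]]]; first by exists 0%N, 0%N.
rewrite order_indexS E /next_order/= ltnS.
by case: ifP => mn'; [exists n, m.+1 | exists n.+1, 0%N].
Qed.

(** The clock advances by 1 for each of the first [2 ^ i.-1] steps and then stands still during the
    orders of size 0; hence the minimum. *)
Lemma cycle_timeE (i j : nat) :
  cycle_time R i j.+1 = cycle_start R i + (minn j (2 ^ i.-1))%:R.
Proof.
rewrite /cycle_time; elim: j => [|j IHj]; first by rewrite min0n addr0.
rewrite -[LHS]/(if (j.+2 <= (2 ^ i.-1).+1)%N then time_in_cycle _ i j.+1 + 1
  else time_in_cycle _ i j.+1) ltnS.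
case: ltnP => ji; rewrite IHj; last by congr (_ + _%:R); lia.
by rewrite (minn_idPl (ltnW ji)) (minn_idPl ji) -addrA natr1.
Qed.

Lemma cycle_startS (n : nat) : cycle_start R n.+2 =
  cycle_start R n.+1 + 2 ^+ n + 2 `^ (n%:R / 2).
Proof.
transitivity (cycle_time R n.+1 (2 ^ n.+1).+1 + 2 `^ ((n.+2%:R - 2) / 2)) => //.
rewrite cycle_timeE -natrX; congr (_ + _%:R + _ `^ (_ / _)).
  by apply/minn_idPr; rewrite leq_exp2l.
by rewrite -addn2 natrD addrK.
Qed.

Lemma cyclic_time_homo : {homo T : k l / (k <= l)%N >-> k <= l}.
Proof.
apply/nondecreasing_seqP => k; rewrite /T/=.
have [n [m [-> mn]]] := order_index_range k; rewrite /next_order/= ltnS.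
case: ifP => mn'/=; rewrite !cycle_timeE.
  by rewrite lerD2l ler_nat /=; lia.
rewrite cycle_startS min0n addr0 -addrA lerD2l.
rewrite (@le_trans _ _ (2 ^+ n)) ?lerDl ?powR_ge0//.
by rewrite -natrX ler_nat geq_minr.
Qed.

Lemma cyclic_size_phase1 (n j : nat) : (j < 2 ^ n)%N ->
  Y (cycle_offset n + j) = 1.
Proof.
move=> jn; rewrite /Y/= order_index_cycle/= /cycle_size ?jn//.
by rewrite expnS; lia.
Qed.

Lemma cyclic_size_large (n : nat) :
  Y (cycle_offset n + 2 ^ n) = 2 `^ (n%:R / 2).
Proof.
rewrite /Y/= order_index_cycle/= ?leq_exp2l// /cycle_size ltnn eqxx.
by rewrite -[n.+1%:R]natr1 addrK.
Qed.

Lemma cyclic_size_zero (n j : nat) : (j < 2 ^ n)%N ->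
  Y (cycle_offset n + (2 ^ n).+1 + j) = 0.
Proof.
move=> jn; rewrite /Y/= -addnA order_index_cycle/= /cycle_size; last first.
  by rewrite expnS; lia.
by rewrite ifF ?ifF//=; lia.
Qed.

(** Demand has rate 1 and every cycle begins and ends at level 0, so the quantity ordered equals the
    elapsed time. *)
Lemma sum_cyclic_size_offset (n : nat) :
  \sum_(k < cycle_offset n) Y k = cycle_start R n.+1.
Proof.
elim: n => [|n IHn]; first by rewrite /cycle_offset !big_ord0.
rewrite cycle_startS.
(* One cycle splits into [2 ^ n] unit orders, one large order and [2 ^ n] orders of size 0. *)
have -> : cycle_offset n.+1 = (cycle_offset n + 2 ^ n + 1 + 2 ^ n)%N.
  by rewrite /cycle_offset big_ord_recr/= expnS; lia.
rewrite !big_split_ord/= IHn.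
rewrite [X in _ + X]big1 => [|j _]; last first.
  by rewrite -(addnA _ (2 ^ n)%N) addn1 cyclic_size_zero.
rewrite addr0 big_ord1 addn0 cyclic_size_large; congr (_ + _ + _).
rewrite (eq_bigr (fun=> 1)) => [|j _]; last by rewrite cyclic_size_phase1.
by rewrite sumr_const card_ord -natrX.
Qed.

Lemma sum_cyclic_size_phase1 (n : nat) :
  \sum_(k < cycle_offset n + 2 ^ n) Y k = cycle_start R n.+1 + 2 ^+ n.
Proof.
rewrite big_split_ord/= sum_cyclic_size_offset; congr (_ + _).
rewrite (eq_bigr (fun=> 1)) => [|j _]; last by rewrite cyclic_size_phase1.
by rewrite sumr_const card_ord -natrX.
Qed.

Lemma cyclic_timeE (n j : nat) : (j <= 2 ^ n.+1)%N ->
  T (cycle_offset n + j) = cycle_start R n.+1 + (minn j (2 ^ n))%:R.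
Proof.
move=> jn; rewrite -(cycle_timeE n.+1 j).
rewrite -[LHS]/(cycle_time R (order_index _).1 (order_index _).2).
by rewrite order_index_cycle.
Qed.

Lemma cyclic_time_phase2 (n j : nat) : (j <= 2 ^ n)%N ->
  T (cycle_offset n + 2 ^ n + j) = cycle_start R n.+1 + 2 ^+ n.
Proof.
move=> jn; rewrite -addnA cyclic_timeE; last by rewrite expnS; lia.
by rewrite -natrX; congr (_ + _%:R); apply/minn_idPr/leq_addr.
Qed.

Lemma cyclic_inventory_left_lim (n : nat) :
  lim (inventory (cyclic_policy R) s
       @[s --> (T (cycle_offset n + 2 ^ n))^'-]) = 0.
Proof.
have n0 : (0 < 2 ^ n)%N by rewrite expn_gt0.
(* The predecessor of the large order is the last unit order, one time unit earlier, which provides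
   the strict gap. *)
have E : (cycle_offset n + 2 ^ n = (cycle_offset n + (2 ^ n).-1).+1)%N by lia.
rewrite {1}E inventory_left_lim -?E; last 2 first.
- exact: cyclic_time_homo.
- rewrite -/T -[X in _ < T X]addn0 cyclic_time_phase2// cyclic_timeE;
    last first.
    by rewrite expnS; lia.
  by rewrite ltrD2l -natrX ltr_nat; lia.
rewrite -/T -[X in - T X]addn0 cyclic_time_phase2//.
by rewrite sum_cyclic_size_phase1 addNr.
Qed.

(** The left limit is 0, and the large order is among the simultaneous orders already applied; the
    others have nonnegative size. *)
Lemma cyclic_level_before_ge (n j : nat) : (j < 2 ^ n)%N ->
  2 `^ (n%:R / 2) <=
  level_before (cyclic_policy R) (cycle_offset n + (2 ^ n).+1 + j).
Proof.
move=> jn; rewrite /level_before -/T.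
have -> : T (cycle_offset n + (2 ^ n).+1 + j) = T (cycle_offset n + 2 ^ n).
  by rewrite addnS addSnnS -[X in _ = T X]addn0 !cyclic_time_phase2.
rewrite cyclic_inventory_left_lim add0r.
have lt : (cycle_offset n + 2 ^ n < cycle_offset n + (2 ^ n).+1 + j)%N by lia.
rewrite (bigD1 (Ordinal lt))// -cyclic_size_large lerDl.
by apply: sumr_ge0 => k _; exact: order_size_ge0.
Qed.

Lemma powR_half_le (n : nat) : 2 `^ (n%:R / 2) <= 2 ^+ n :> R.
Proof.
rewrite -powR_mulrn//; apply: ler_powR; first by rewrite ler1n.
by rewrite ler_pdivrMr// ler_peMr// ler1n.
Qed.

(** Bounding [2 ^ (n/2)] by [2 ^ n] closes the induction: 2 + 1 + 1 = 2 * 2. *)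
Lemma cycle_start_le (n : nat) : cycle_start R n.+1 <= 2 * 2 ^+ n.
Proof.
elim: n => [|n IHn]; first by rewrite mulr_ge0.
by rewrite cycle_startS exprS; have := powR_half_le n; lra.
Qed.

End CyclicPolicy.

Lemma compact_fst_bounded (R : realType) (G : set (R * R)) : compact G ->
  exists M : R, forall u, G u -> u.1 <= M.
Proof.
move=> cG; have [M [_ MG]] := compact_bounded cG.
(* [compact_bounded] bounds the norm only by numbers strictly above [M]. *)
exists (M + 1) => u Gu; rewrite (le_trans (ler_norm _))//.
by rewrite (le_trans _ (MG (M + 1) _ u Gu)) ?ltrDl// prod_normE le_max lexx.
Qed.

Theorem proposition2p5 (R : realType) :
  not_tight (avg_ordering_measure (cyclic_policy R)).
Proof.
(* Any constant in ]0, 1/3[ would do, since the mass found is at least 1/3. *)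
exists 4^-1; split; first by rewrite invr_gt0.
move=> G cG _; have [M MG] := compact_fst_bounded cG.
have [m Mm] : exists m, M < 2 ^+ m.
  exists (Num.bound `|M|); rewrite (le_lt_trans (ler_norm _))//.
  by rewrite (lt_trans (archi_boundP _))// -natrX ltr_nat ltn_expl.
(* With [n] even, the level [2 ^ (n/2)] is the integer power [2 ^ m], which exceeds [M]. *)
pose n := (2 * m)%N; pose p := cyclic_policy R.
pose t := order_time p (cycle_offset n + 2 ^ n).
have tE : t = cycle_start R n.+1 + 2 ^+ n.
  by rewrite /t -[X in order_time p X]addn0 cyclic_time_phase2.
have s0 : 0 <= cycle_start R n.+1.
  rewrite -sum_cyclic_size_offset; apply: sumr_ge0 => k _.
  exact: order_size_ge0.
have n0 : 0 < 2 ^+ n :> R by rewrite exprn_gt0.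
have t0 : 0 < t by rewrite tE ltr_wpDl.
exists t; split => //; rewrite /avg_ordering_measure -/p.
pose f k : \bar R :=
  (\1_(@Rbar R `\` G) (level_before p k, level_after p k))%:E.
have f0 k : (0 <= f k)%E by rewrite lee_fin.
have f1 j : (j < 2 ^ n)%N -> f (cycle_offset n + (2 ^ n).+1 + j)%N = 1%E.
  move=> jn; rewrite /f indicE mem_set//; split.
    by rewrite /Rbar/= /level_after lerDl order_size_ge0.
  move=> /MG/=; apply/negP; rewrite -ltNge (lt_le_trans Mm)//.
  apply: le_trans (cyclic_level_before_ge R jn).
  by rewrite /n natrM mulrAC divff ?mul1r ?powR_mulrn.
have sumf : ((2 ^+ n)%:E <= \sum_(k <oo | (order_time p k <= t)%R) f k)%E.
  (* Terms are nonnegative, so the partial sum up to the end of cycle [n.+1] is a lower bound; the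
     orders of size 0 occur exactly at [t] and count 1 each. *)
  apply: le_trans
    (nneseries_lim_ge (cycle_offset n + (2 ^ n).+1 + 2 ^ n) _) => //.
  rewrite big_mkord big_mkcond/= big_split_ord/= -[leLHS]add0e leeD//.
    by apply: sume_ge0 => k _; case: ifP.
  rewrite (eq_bigr (fun=> 1%E)) => [|j _]; last first.
    by rewrite ifT ?f1// tE -(cyclic_time_phase2 R (ltn_ord j)) addnS addSnnS.
  by rewrite sumEFin sumr_const card_ord -natrX.
apply: lt_le_trans (lee_wpmul2l _ sumf); last by rewrite lee_fin invr_ge0 ltW.
rewrite -EFinM lte_fin mulrC ltr_pdivlMr// tE.
by have := cycle_start_le R n; lra.
Qed.
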